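(* Let $H:\mathbb R\to\mathbb R$ be an even function, increasing on $\mathbb R^+$, with $H(0)=0$ and $H(x)\ge c x^2$ for all $x$, for some constant $c>0$. Assume that there exists $q\ge 2$ such that $x\mapsto H(x)/x^q$ is non-increasing on $(0,+\infty)$. Let $F:(0,+\infty)\to\mathbb R$ be a non-decreasing function with $F(1)=0$, such that $x\mapsto xF(x)$ is bounded from below and such that one of the following properties holds for some $A>1$: (i) the function $\Phi(x)=xF(x)$ extends to a $\mathcal C^2$-function on $[0,A^2]$; (ii) there exists a constant $d\ge 0$ such that $F(x)\le d(x-1)$ for all $x\in(0,A^2]$. Let $\mu$ be a probability measure satisfying, for some constant $D\ge 0$ and all $f$, the defective modified $F$-Sobolev inequality $$\int f^2F\left(\frac{f^2}{\int f^2\,d\mu}\right)d\mu\le \int f^2H\left(\frac{|\nabla f|}{f}\right)d\mu+D\int f^2\,d\mu .$$ If $\mu$ also satisfies a Poincaré inequality, then there exists a constant $C$ such that for every $f$, $$\int f^2F\left(\frac{f^2}{\int f^2\,d\mu}\right)d\mu\le C\int f^2H\left(\frac{|\nabla f|}{f}\right)d\mu .$$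
   Context: $\mu$ is a probability measure on a Riemannian manifold (for instance $\mathbb R^d$), absolutely continuous with respect to the Riemannian volume. ''For all $f$'' means for all locally Lipschitz functions $f$ with $0<\int f^2d\mu<\infty$. At points where $f=0$ (where $\nabla f=0$ almost everywhere) the integrand $f^2H(|\nabla f|/f)$ is $0$, and $f^2F(f^2/\int f^2d\mu)$ is interpreted as $\left(\int f^2 d\mu\right)\Phi(0)$, where $\Phi(0)$ is the value of the extension of $\Phi$ at $0$ in case (i), and $0$ in case (ii). $\mu$ satisfies a Poincaré inequality if there is $E<\infty$ such that for all locally Lipschitz $f$, $\int |f-\int f\,d\mu|^2d\mu\le E\int|\nabla f|^2d\mu$. *)

(* Defs.v *)
From HB Require Import structures.
From mathcomp Require Import all_boot all_order all_algebra.
From mathcomp Require Import all_classical all_reals all_analysis.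

Set Implicit Arguments.
Unset Strict Implicit.
Unset Printing Implicit Defensive.
Import Order.TTheory GRing.Theory Num.Theory.
Import numFieldNormedType.Exports.

Local Open Scope classical_set_scope.
Local Open Scope ring_scope.

Notation borel T := (g_sigma_algebraType (@open T)).

(** n-fold product of the Lebesgue measure of the line, as an iterated
    integral over slices. *)
Fixpoint lebesgue_rV (R : realType) (n : nat) : set 'rV[R]_n -> \bar R :=
  match n return set 'rV[R]_n -> \bar R with
  | 0 => fun A => (\1_A (0 : 'rV[R]_0))%:E
  | m.+1 => fun A =>
      (\int[@lebesgue_measure R]_x
         lebesgue_rV [set y : 'rV[R]_m | A (row_mx (x%:M : 'rV[R]_1) y)])%E
  end.

Section Smooth.
Variables (R : realType) (n : nat).
Implicit Types (U : set 'rV[R]_n) (f : 'rV[R]_n -> R).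

Definition pderiv (k : 'I_n) f : 'rV[R]_n -> R := 'D_(delta_mx 0 k) f.

(** To be used on open sets [U] only. *)
Fixpoint Ck_on (k : nat) U f : Prop :=
  {in U, continuous f} /\
  match k with
  | 0 => True
  | k'.+1 => forall i : 'I_n,
      (forall p, U p -> derivable f p (delta_mx 0 i)) /\
      Ck_on k' U (pderiv i f)
  end.

Definition smooth_on U f : Prop := forall k, Ck_on k U f.

End Smooth.

(** A smooth Riemannian structure of dimension [n] on the space [M], given by
    an atlas.  Vectors are row vectors, so that ['d f p v = v *m 'J f p], and
    [metric i p] is the Gram matrix of the metric in the chart [i], at the point
    of coordinates [p]. *)
Record riemannian (R : realType) (n : nat) (M : ptopologicalType) := Riemannian {
  chart : Type;
  dom : chart -> set M;
  coord : chart -> M -> 'rV[R]_n;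
  param : chart -> 'rV[R]_n -> M;
  metric : chart -> 'rV[R]_n -> 'M[R]_n;
  riem_hausdorff : hausdorff_space M;
  riem_second_countable : @second_countable M;
  dom_cover : forall x, exists i, dom i x;
  dom_open : forall i, open (dom i);
  im_open : forall i, open (coord i @` dom i);
  coordK : forall i x, dom i x -> param i (coord i x) = x;
  coord_cont : forall i, {in dom i, continuous (coord i)};
  param_cont : forall i, {in coord i @` dom i, continuous (param i)};
  transition_smooth : forall i j (l : 'I_n),
    smooth_on (coord i @` (dom i `&` dom j))
              (fun p => coord j (param i p) 0 l);
  metric_smooth : forall i (k l : 'I_n),
    smooth_on (coord i @` dom i) (fun p => metric i p k l);
  metric_sym : forall i p, (coord i @` dom i) p -> (metric i p)^T = metric i p;
  metric_pos : forall i p (v : 'rV[R]_n), (coord i @` dom i) p -> v != 0 ->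
    0 < (v *m metric i p *m v^T) 0 0;
  metric_compat : forall i j p, (coord i @` (dom i `&` dom j)) p ->
    let tau := coord j \o param i in
    metric i p = 'J tau p *m metric j (tau p) *m ('J tau p)^T
}.

Section Geometry.
Variables (R : realType) (n : nat) (M : ptopologicalType).
Variable G : riemannian R n M.

Definition is_volume (vol : set (borel M) -> \bar R) : Prop :=
  forall (i : chart G) (A : set (borel M)), measurable A -> A `<=` dom i ->
    vol A = (\int[(@lebesgue_rV R n : set (borel 'rV[R]_n) -> \bar R)]_(p in
               coord i @` A) (Num.sqrt (\det (metric i p)))%:E)%E.

Definition locally_lipschitz (f : M -> R) : Prop :=
  forall (i : chart G) x, dom i x -> exists2 U : set 'rV[R]_n,
    nbhs (coord i x) U & [lipschitz (f \o param i) y | y in U].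

(** Some chart around [x]; where [f] is differentiable [grad_norm f x] does not
    depend on that choice. *)
Definition chart_at (x : M) : chart G := sval (cid (dom_cover G x)).

(** The Riemannian norm of the gradient of [f].  A locally Lipschitz function is
    differentiable almost everywhere; where [f] is not differentiable the value
    is set to 0. *)
Definition grad_norm (f : M -> R) (x : M) : R :=
  let i := chart_at x in
  let p := coord i x in
  let h := f \o param i in
  let v := (\row_k pderiv k h p) *m invmx (metric i p) in
  if `[< differentiable h p >] then Num.sqrt ((v *m metric i p *m v^T) 0 0)
  else 0.

End Geometry.

(** Twice continuously differentiable on the set [D] (one-sidedly at boundary
    points). *)
Definition has_deriv_within (R : realType) (D : set R) (f : R -> R) (x l : R) :=
  (fun y => (f y - f x) / (y - x)) @ within D x^' --> l.

Definition C2_on (R : realType) (D : set R) (f : R -> R) : Prop :=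
  exists f1 f2 : R -> R,
    [/\ forall x, D x -> has_deriv_within D f x (f1 x),
        forall x, D x -> has_deriv_within D f1 x (f2 x) &
        {within D, continuous f2}].

Section Inequalities.
Variables (R : realType) (n : nat) (M : ptopologicalType).
Variables (G : riemannian R n M) (mu : probability (borel M) R).

Definition mass (f : M -> R) : R := \int[mu]_x (f x ^+ 2).

Definition admissible (f : M -> R) : Prop :=
  locally_lipschitz G f /\ (0 < \int[mu]_x (f x ^+ 2)%:E < +oo)%E.

(** [f^2 F(f^2 / mass f)], where [Phi0] stands for the value of [x F(x)] at 0. *)
Definition F_integrand (F : R -> R) (Phi0 : R) (f : M -> R) (x : M) : R :=
  if f x == 0 then mass f * Phi0 else f x ^+ 2 * F (f x ^+ 2 / mass f).

Definition H_integrand (H : R -> R) (f : M -> R) (x : M) : R :=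
  if f x == 0 then 0 else f x ^+ 2 * H (grad_norm G f x / f x).

Definition poincare : Prop :=
  exists E : R, forall f, locally_lipschitz G f ->
    mu.-integrable setT (EFin \o f) ->
    (\int[mu]_x (`|f x - \int[mu]_y f y| ^+ 2)%:E <=
     E%:E * \int[mu]_x (grad_norm G f x ^+ 2)%:E)%E.

End Inequalities.

(* Main.v *)
Require Import Defs.
From mathcomp Require Import all_boot all_order all_algebra.
From mathcomp Require Import all_classical all_reals all_analysis.
From mathcomp Require Import measurable_realfun.
From mathcomp Require Import ring lra.

Set Implicit Arguments.
Unset Strict Implicit.
Unset Printing Implicit Defensive.
Import Order.TTheory GRing.Theory Num.Theory.
Import numFieldNormedType.Exports HBNNSimple.
Local Open Scope classical_set_scope.
Local Open Scope ring_scope.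

(** Both sides of the inequality are homogeneous of degree 2 in [f] and depend
    on [`|f|] only, so one may assume [0 <= f] and that [f ^+ 2] has integral 1
    (Section [Normalization]).  Write V for the integral of [(f - 1) ^+ 2]. It is
    at most twice the variance of [f], because the mean of [f] lies between 0
    and 1, and the Poincare inequality together with [c * x ^+ 2 <= H x] bounds
    it by a multiple of the energy, the integral of [f ^+ 2 * H (|grad f| / f)]
    ([variance_energy]).  It is thus enough to bound the left-hand side by the
    energy and V.  The values of [f] below and above [A] are treated separately.

    Below [A], either hypothesis on [F] places the graph of [x * F x] under a
    parabola [a * (x - 1) + K * (x - 1) ^+ 2] with [0 <= a]
    ([quadratic_majorant]).  At [x = f ^+ 2] the linear term has integral 0 and
    the quadratic one is at most a multiple of V ([F_integral_majorant]).

    Above [A], the defective inequality is applied to [g = psi (f)], where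
    [psi t = ((t `^ (2 / q) - 1)_+) `^ (q / 2)].  Three features of [psi] matter.
    - It is 1-Lipschitz and vanishes at 1, so [g ^+ 2 <= (f - 1) ^+ 2]: the
      defect [D] times the mass of [g] is at most [D * V].
    - Its logarithmic derivative [t * psi' t / psi t] is at least 1, and its
      [q]-th power times [psi t ^+ 2] is exactly [t ^+ 2]; as [H x / x `^ q]
      decreases, the energy density of [g] is at most that of [f].
    - [psi t / t] increases, so [th * f <= g] where [A <= f], with
      [th = psi A / A].  If V is less than [th ^+ 2], the mass of [g] is less
      than [th ^+ 2] too, and [g ^+ 2] divided by its mass is at least
      [f ^+ 2]: the [F]-term of [g] controls that of [f] above [A], up to a
      multiple of V that absorbs the values where [x * F x] is negative
      ([high_part_bound]).
    If instead V is at least [th ^+ 2], the defect of the inequality for [f]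
    itself is at most [D / th ^+ 2 * V].

    Two points make these computations legitimate.  First, the gradient is
    treated as a possibly non-measurable function, whose integral is a lower
    integral, the supremum over the simple functions below it; such integrals
    enter only through monotonicity and homogeneity, and sums are split only for
    functions of the values of [f].  Second, the chain rule
    [grad_norm_comp] holds at every point: the maps composed with [f] are
    locally invertible with differentiable inverse wherever the integrands do
    not vanish, so that the composition is differentiable exactly where [f] is,
    in agreement with the convention that the gradient is 0 elsewhere. *)

(** * Lower integrals

    The integral is defined for every function, as a difference of two lower
    integrals. *)

(** The positive part increases and the negative part decreases with the
    function, and a supremum over a larger set of simple functions is larger. *)
Lemma le_lower_integral d (T : measurableType d) (R : realType)
    (mu : {measure set T -> \bar R}) (u v : T -> \bar R) :
  (forall x, u x <= v x)%E -> (\int[mu]_x u x <= \int[mu]_x v x)%E.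
Proof.
move=> uv; rewrite /integral /= !patch_setT; apply: leeB; apply: ereal_sup_le.
  move=> _ [h /= hu <-]; exists h => //= x; apply: (le_trans (hu x)).
  by apply: (@funepos_le _ _ setT); rewrite ?inE// => y _; exact: uv.
move=> _ [h /= hv <-]; exists h => //= x; apply: (le_trans (hv x)).
by apply: (@funeneg_le _ _ setT); rewrite ?inE// => y _; exact: uv.
Qed.

Lemma lower_integralZl_le d (T : measurableType d) (R : realType)
    (mu : {measure set T -> \bar R}) (k : R) (u : T -> \bar R) :
  0 < k -> (forall x, 0 <= u x)%E ->
  (\int[mu]_x (k%:E * u x) <= k%:E * \int[mu]_x u x)%E.
Proof.
move=> k0 u0; have ku0 x : (0 <= k%:E * u x)%E by rewrite mule_ge0// lee_fin ltW.
have ki0 : 0 <= k^-1 by rewrite invr_ge0 ltW.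
rewrite (ge0_integralTE _ ku0) (ge0_integralTE _ u0).
apply: ge_ereal_sup => _ [h /= hu <-].
have hE : (h : T -> R) = (cst k \* scale_nnsfun h ki0)%R.
  by apply/funext => x /=; rewrite mulrA divff ?mul1r// gt_eqF.
rewrite hE sintegralrM lee_pmul2l//; apply: ereal_sup_ubound => /=.
exists (scale_nnsfun h ki0) => // x /=.
rewrite -(@lee_pmul2l _ k%:E)//.
by rewrite -EFinM mulrA divff ?mul1r ?gt_eqF.
Qed.

Lemma lower_integralZl d (T : measurableType d) (R : realType)
    (mu : {measure set T -> \bar R}) (k : R) (u : T -> \bar R) :
  0 < k -> (\int[mu]_x (k%:E * u x) = k%:E * \int[mu]_x u x)%E.
Proof.
move=> k0.
have nn (w : T -> \bar R) : (forall x, 0 <= w x)%E ->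
    (\int[mu]_x (k%:E * w x) = k%:E * \int[mu]_x w x)%E.
  move=> w0; apply/eqP; rewrite eq_le lower_integralZl_le//=.
  have kw0 x : (0 <= k%:E * w x)%E by rewrite mule_ge0// lee_fin ltW.
  have ki0 : 0 < k^-1 by rewrite invr_gt0.
  have kK (y : \bar R) : (k^-1%:E * (k%:E * y) = y)%E.
    by rewrite muleA -EFinM mulVf ?mul1e// gt_eqF.
  have := lower_integralZl_le mu ki0 kw0.
  under eq_integral do rewrite kK.
  rewrite -(@lee_pmul2l _ k%:E)// muleA -EFinM divff ?mul1e//.
  by rewrite gt_eqF.
have subE (a b : \bar R) : (k%:E * (a - b) = k%:E * a - k%:E * b)%E.
  case: a b => [a||] [b||] //=; rewrite ?(gt0_muley, gt0_muleNy, lte_fin)//.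
  by rewrite -EFinD -!EFinM -EFinD mulrBr.
have pos (w : T -> \bar R) x : ((fun y => k%:E * w y) ^\+ x = k%:E * w ^\+ x)%E.
  rewrite !funeposE /maxe; have : ((k%:E * w x < 0) = (w x < 0))%E.
    by rewrite -[X in (_ < X)%E](mule0 k%:E) lte_pmul2l.
  by move=> ->; case: ifP => //; rewrite mule0.
have neg (w : T -> \bar R) x : ((fun y => k%:E * w y) ^\- x = k%:E * w ^\- x)%E.
  rewrite !funenegE /maxe -muleN; have : ((k%:E * - w x < 0) = (- w x < 0))%E.
    by rewrite -[X in (_ < X)%E](mule0 k%:E) lte_pmul2l.
  by move=> ->; case: ifP => //; rewrite mule0.
rewrite integralE [in RHS]integralE subE -!nn//.
by congr (_ - _)%E; apply: eq_integral => x _; rewrite ?pos ?neg.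
Qed.

(** A bound on [h] that tolerates a non-measurable [w] and infinite integrals:
    on a probability space, integrating [h - c] only loses [c].  Subtracting
    integrals would be meaningless when [h] is not integrable, so the identity
    [h + (h - c)^- = (h - c)^+ + c] between nonnegative functions is integrated
    instead; the negative part is bounded by [c], hence has a finite integral
    that can be moved across. *)
Lemma integral_le_addr_cst d (T : measurableType d) (R : realType)
    (mu : probability T R) (h w : T -> R) (c : R) :
  measurable_fun setT h -> 0 <= c -> (forall x, 0 <= h x) ->
  (forall x, h x <= w x + c) ->
  (\int[mu]_x (h x)%:E <= \int[mu]_x (w x)%:E + c%:E)%E.
Proof.
move=> mh c0 h0 hw.
pose hc x : \bar R := (h x - c)%:E.
have mhc : measurable_fun setT hc.
  by apply/measurable_EFinP; apply: measurable_funB.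
have cE : (\int[mu]_x cst c%:E x = c%:E)%E.
  by rewrite integral_cst// -[X in (_ * X)%E]/(mu setT) probability_setT mule1.
have negc : (\int[mu]_x hc^\- x <= c%:E)%E.
  rewrite -cE; apply: le_lower_integral => x /=.
  rewrite funenegE /hc -EFinN /maxe; case: ifP => _; rewrite lee_fin//.
  by rewrite opprB lerBlDr lerDl.
have neg0 : (0 <= \int[mu]_x hc^\- x)%E by apply: integral_ge0.
have negfin : (\int[mu]_x hc^\- x)%E \is a fin_num.
  by rewrite ge0_fin_numE// (le_lt_trans negc)// ltry.
have : (\int[mu]_x (h x)%:E + \int[mu]_x hc^\- x
        = \int[mu]_x hc^\+ x + \int[mu]_x cst c%:E x)%E.
  rewrite -!ge0_integralD//.
  - apply: eq_integral => x _ /=.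
    rewrite funeposE funenegE /hc -!EFinN -!EFin_max -!EFinD; congr EFin.
    by rewrite /Num.max; case: ltP => ?; case: ltP => ?; lra.
  all: try exact: measurable_funepos.
  all: try exact: measurable_funeneg.
  all: try exact/measurable_EFinP.
  by move=> x _; rewrite lee_fin.
rewrite cE => hE.
have -> : (\int[mu]_x (h x)%:E
   = \int[mu]_x hc^\+ x + c%:E - \int[mu]_x hc^\- x)%E.
  by rewrite -hE addeK.
rewrite addeAC leeD2r// -integralE.
by apply: le_lower_integral => x; rewrite lee_fin lerBlDr.
Qed.

(** Additivity, allowing [h] to have an infinite integral, in which case the
    right-hand side is infinite. *)
Lemma integralD_le d (T : measurableType d) (R : realType)
    (mu : {measure set T -> \bar R}) (v h : T -> \bar R) :
  mu.-integrable setT v -> measurable_fun [set: T] h -> (forall x, 0 <= h x)%E ->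
  (\int[mu]_x (v x + h x) <= \int[mu]_x v x + \int[mu]_x h x)%E.
Proof.
move=> iv mh h0; have [hoo|] := ltP (\int[mu]_x h x)%E +oo%E.
  rewrite integralD//; apply/integrableP; split => //.
  by under eq_integral do rewrite gee0_abs//.
rewrite leye_eq => /eqP ->.
rewrite addey ?leey//.
by have := integrable_fin_num measurableT iv; case: integral.
Qed.

Lemma continuous_borel_measurable (R : realType) (M : ptopologicalType) (f : M -> R) :
  continuous f -> measurable_fun setT (f : borel M -> R).
Proof.
move=> /continuousP cf.
apply: (measurability _ (RGenOpens.measurableE R)) => _ [B [a [b ->] <-]].
rewrite setTI; apply: sub_sigma_algebra; apply: cf; exact: interval_open.
Qed.

(** * The gradient of a composition *)

Lemma lipschitz_boundP (R : realType) (V : normedModType R) (h : V -> R) (U : set V) :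
  [lipschitz h y | y in U] <->
  exists2 K, 0 < K & forall y z, U y -> U z -> `|h y - h z| <= K * `|y - z|.
Proof.
split=> [/pinfty_ex_gt0[K K0 hK]|[K K0 hK]].
  by exists K => // y z Uy Uz; exact: (hK (y, z)).
exists K; split; first exact: num_real.
move=> k Kk -[y z] [/= Uy Uz]; apply: (le_trans (hK _ _ Uy Uz)).
by rewrite ler_wpM2r// ltW.
Qed.

Lemma lipschitz_nbhs_continuous (R : realType) (V : normedModType R) (h : V -> R)
    (p : V) (U : set V) :
  nbhs p U -> [lipschitz h y | y in U] -> {for p, continuous h}.
Proof.
move=> nU /lipschitz_boundP[K K0 hK]; apply/cvgrPdist_le => e e0.
near=> y; have Uy : U y by near: y.
apply: (le_trans (hK _ _ (nbhs_singleton nU) Uy)); rewrite -ler_pdivlMl// mulrC.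
near: y; have := @cvg_id _ (nbhs p).
by move=> /cvgrPdist_le; apply; rewrite divr_gt0.
Unshelve. all: by end_near. Qed.

(** The affine approximation of [h2] at [p] is one of [h1], by uniqueness of the
    differential. *)
Lemma near_eq_differentiable (R : realType) (V W : normedModType R)
    (h1 h2 : V -> W) (p : V) :
  (\forall y \near p, h1 y = h2 y) ->
  differentiable h2 p -> differentiable h1 p.
Proof.
move=> h12 dh2; have h12p := nbhs_singleton h12.
have [cd2 E2] := (diff_locallyP p h2).1 dh2.
suff E1 : h1 \o shift p = cst (h1 p) + 'd h2 p +o_ (0 : V) id.
  apply/diff_locallyP; have dE := diff_unique cd2 E1.
  by rewrite dE.
apply/eqaddoP => e e0.
have h12s : \forall y \near (0 : V), h1 (y + p) = h2 (y + p).
  by move: h12; rewrite (near_shift 0) subr0.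
have {}E2 := (@eqaddoP _ _ _ _ _ _ _ _).1 E2 e e0.
near=> y.
have hy : h1 (y + p) = h2 (y + p) by near: y.
have : `|(h2 \o shift p - (cst (h2 p) + 'd h2 p)) y| <= e * `|y| by near: y; exact: E2.
by rewrite -![(_ - _ : _ -> _) _]/(_ - _) -![(_ + _ : _ -> _) _]/(_ + _) /= hy h12p.
Unshelve. all: by end_near. Qed.

(** The difference quotient is nonnegative on the right of 0 and nonpositive on
    its left. *)
Lemma derive_at_zero_minimum (R : realType) (V : normedModType R) (h : V -> R) (p v : V) :
  (forall y, 0 <= h y) -> h p = 0 -> derivable h p v -> 'D_v h p = 0.
Proof.
move=> h0 hp dh.
have cq : (fun t => t^-1 *: ((h \o shift p) (t *: v) - h p)) @ 0^' --> 'D_v h p.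
  exact: dh.
apply/eqP; rewrite eq_le; apply/andP; split.
- have cl : (fun t => t^-1 *: ((h \o shift p) (t *: v) - h p)) @ 0^'- --> 'D_v h p.
    apply: cvg_trans cq; apply: cvg_app => P [e e0 eP]; exists e => // y ey y0.
    by apply: eP => //; rewrite lt_eqF.
  rewrite -(cvg_lim _ cl)//; apply: limr_le; first by apply/cvg_ex; exists ('D_v h p).
  near=> t; rewrite hp subr0 /= mulr_le0_ge0// invr_le0.
  by near: t; exact: nbhs_left_le.
- have cl : (fun t => t^-1 *: ((h \o shift p) (t *: v) - h p)) @ 0^'+ --> 'D_v h p.
    apply: cvg_trans cq; apply: cvg_app => P [e e0 eP]; exists e => // y ey y0.
    by apply: eP => //; rewrite gt_eqF.
  rewrite -(cvg_lim _ cl)//; apply: limr_ge; first by apply/cvg_ex; exists ('D_v h p).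
  near=> t; rewrite hp subr0 /= mulr_ge0// invr_ge0.
  by near: t; exact: nbhs_right_ge.
Unshelve. all: by end_near. Qed.

Section Gradient.
Variables (R : realType) (n : nat) (M : ptopologicalType) (G : riemannian R n M).

Lemma locally_lipschitz_continuous (f : M -> R) :
  locally_lipschitz G f -> continuous f.
Proof.
move=> lf x; have [i ix] := dom_cover G x.
have [U nU lU] := lf i x ix.
have hc := lipschitz_nbhs_continuous nU lU.
have : (f \o param i \o Defs.coord i) y @[y --> x] -->
    (f \o param i \o Defs.coord i) x.
  apply: continuous_comp => //; apply: coord_cont; exact: mem_set.
rewrite [in X in _ --> X]/= coordK//; apply: cvg_trans; apply: near_eq_cvg.
near=> y; rewrite /= coordK//; near: y.
by apply: open_nbhs_nbhs; split => //; exact: dom_open.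
Unshelve. all: by end_near. Qed.

Lemma locally_lipschitz_comp (f : M -> R) (theta : R -> R) (k : R) :
  0 < k -> (forall s t, `|theta s - theta t| <= k * `|s - t|) ->
  locally_lipschitz G f -> locally_lipschitz G (theta \o f).
Proof.
move=> k0 hk lf i x ix; have [U nU /lipschitz_boundP[K K0 hK]] := lf i x ix.
exists U => //; apply/lipschitz_boundP; exists (k * K); first exact: mulr_gt0.
move=> y z Uy Uz; apply: (le_trans (hk _ _)).
rewrite -mulrA; apply: ler_wpM2l; [exact: ltW|exact: hK].
Qed.

Lemma chart_atP x : dom (chart_at G x) x.
Proof. exact: svalP (cid (dom_cover G x)). Qed.

Lemma pderiv_comp (theta : R -> R) (h : 'rV[R]_n -> R) (p : 'rV[R]_n) (l : R) k :
  is_derive (h p) 1 theta l -> differentiable h p ->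
  pderiv k (theta \o h) p = l * pderiv k h p.
Proof.
move=> dth dh; have dt : differentiable theta (h p) by exact/derivable1_diffP.
rewrite /pderiv !deriveE//; last exact: differentiable_comp.
rewrite diff_comp//= diff1E// derive1E derive_val /=.
by rewrite mulrC.
Qed.

(** The chain rule, whether or not [f] is differentiable at [x].  The local
    inverse [phi] is there to transfer differentiability from [theta \o f] back
    to [f]: without it [theta \o f] could be differentiable, with a nonzero
    gradient, at a point where [f] is not and where [grad_norm] is set to 0. *)
Lemma grad_norm_comp (f : M -> R) (theta phi : R -> R) (x : M) (l : R) :
  continuous f -> is_derive (f x) 1 theta l ->
  (\forall t \near f x, phi (theta t) = t) -> derivable phi (theta (f x)) 1 ->
  grad_norm G (theta \o f) x = `|l| * grad_norm G f x.
Proof.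
move=> cf dth phiK dphi; rewrite /grad_norm.
set i := chart_at G x; set p := Defs.coord i x; have ix := chart_atP x.
have px : param i p = x by exact: coordK.
have hpx : (f \o param i) p = f x by rewrite /= px.
have ch : {for p, continuous (f \o param i)}.
  apply: continuous_comp; last exact: cf.
  by apply: param_cont; apply: mem_set; exists x.
have diffE : differentiable (theta \o f \o param i) p <->
    differentiable (f \o param i) p.
  split=> dh.
    apply: (@near_eq_differentiable _ _ _ _ (phi \o (theta \o f \o param i))).
      have chp : (f \o param i) y @[y --> p] --> f x by rewrite -hpx; exact: ch.
      near=> y; apply/esym; near: y; exact: chp _ phiK.
    by apply: differentiable_comp => //=; rewrite px; exact/derivable1_diffP.
  apply: (@differentiable_comp _ _ _ _ (f \o param i) theta) => //.
  by rewrite hpx; exact/derivable1_diffP.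
case: asboolP => [/diffE dh|ndh]; case: asboolP => [|] //; last 2 first.
- by move=> /diffE.
- by rewrite mulr0.
move=> _.
have -> : \row_k pderiv k (theta \o f \o param i) p =
    l *: \row_k pderiv k (f \o param i) p.
  apply/rowP => k; rewrite !mxE.
  have dth' : is_derive ((f \o param i) p) 1 theta l by rewrite hpx.
  exact: pderiv_comp dth' dh.
rewrite -!scalemxAl linearZ /= -scalemxAr scalerA mxE -expr2.
by rewrite sqrtrM ?sqr_ge0// sqrtr_sqr.
Unshelve. all: by end_near. Qed.

Lemma grad_norm_ge0 (f : M -> R) (x : M) : 0 <= grad_norm G f x.
Proof. by rewrite /grad_norm; case: asboolP => // _; exact: sqrtr_ge0. Qed.

Lemma grad_norm_at_zero (f : M -> R) (x : M) :
  (forall y, 0 <= f y) -> f x = 0 -> grad_norm G f x = 0.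
Proof.
move=> f0 fx; rewrite /grad_norm; case: asboolP => // dh.
have -> : \row_k pderiv k (f \o param (chart_at G x)) (Defs.coord (chart_at G x) x)
    = 0.
  apply/rowP => k; rewrite !mxE; apply: derive_at_zero_minimum => //=.
    by rewrite coordK//; exact: chart_atP.
  exact: diff_derivable.
by rewrite !mul0mx mxE sqrtr0.
Qed.

End Gradient.

(** * The power truncation *)

Section Truncation.
Variables (R : realType) (q : R).
Hypothesis q2 : 2 <= q.

(** The [q / 2]-th power of [(t `^ (2 / q) - 1)_+].  Subtracting 1 after
    passing to the root, rather than from [t], is what makes the identity
    [truncation_log_deriv] exact. *)
Definition truncation (t : R) : R :=
  if 1 < t then (t `^ (2 / q) - 1) `^ (q / 2) else 0.

Definition truncation_deriv (t : R) : R :=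
  (t `^ (2 / q) - 1) `^ (q / 2 - 1) * t `^ (2 / q - 1).

Local Notation al := (2 / q).
Local Notation p := (q / 2).
Local Notation psi := truncation.
Local Notation psi' := truncation_deriv.

Let q0 : 0 < q. Proof. by rewrite (lt_le_trans _ q2). Qed.
Let al0 : 0 < al. Proof. by rewrite divr_gt0. Qed.
Let al1 : al <= 1. Proof. by rewrite ler_pdivrMr// mul1r. Qed.
Let p1 : 1 <= p. Proof. by rewrite ler_pdivlMr// mul1r. Qed.
Let p0 : 0 < p. Proof. exact: lt_le_trans p1. Qed.
Let alp : al * p = 1.
Proof. by rewrite mulrA divfK ?divff ?gt_eqF. Qed.

Let root_gt1 (t : R) : 1 < t -> 1 < t `^ al.
Proof.
move=> t1; have := @gt0_ltr_powR R al al0 1 t.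
rewrite !nnegrE powR1; apply => //; exact: le_trans (ltW t1).
Qed.

Let rootK (t : R) : 0 <= t -> (t `^ al) `^ p = t.
Proof. by move=> t0; rewrite -powRrM alp powRr1. Qed.

Lemma truncation_ge0 (t : R) : 0 <= psi t.
Proof. by rewrite /psi; case: ifP => // _; exact: powR_ge0. Qed.

Lemma truncation_gt0 (t : R) : 1 < t -> 0 < psi t.
Proof. by move=> t1; rewrite /psi t1 powR_gt0// subr_gt0 root_gt1. Qed.

Lemma truncation_le1 (t : R) : t <= 1 -> psi t = 0.
Proof. by move=> t1; rewrite /psi ltNge t1. Qed.

Lemma is_derive_truncation (t : R) : 1 < t -> is_derive t 1 psi (psi' t).
Proof.
move=> t1; have t0 : 0 < t by exact: lt_trans t1.
have w0 : 0 < t `^ al - 1 by rewrite subr_gt0 root_gt1.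
have d1 : is_derive t 1 (fun s : R => s `^ al - 1) (al * t `^ (al - 1)).
  have dp := is_derive1_powR al t0.
  have : is_derive t 1 ((@powR R ^~ al : R -> R) - cst 1) (al * t `^ (al - 1) - 0).
    exact: is_deriveB.
  by rewrite subr0.
have d2 : is_derive (t `^ al - 1) 1 (@powR R ^~ p) (p * (t `^ al - 1) `^ (p - 1)).
  exact: is_derive1_powR.
have := @is_derive1_comp R (@powR R ^~ p) (fun s => s `^ al - 1) t _ _ d2 d1.
have -> : p * (t `^ al - 1) `^ (p - 1) * (al * t `^ (al - 1)) = psi' t.
  by rewrite mulrACA (mulrC p) alp mul1r.
apply: near_eq_is_derive.
near=> s; rewrite /psi /= ifT//; near: s; exact: lt_nbhsr.
Unshelve. all: by end_near. Qed.

Lemma truncation_deriv_gt0 (t : R) : 1 < t -> 0 < psi' t.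
Proof.
move=> t1; rewrite mulr_gt0// powR_gt0 ?subr_gt0 ?root_gt1//.
exact: lt_trans t1.
Qed.

(** With [s = t `^ (2 / q)], the derivative is [((s - 1) / s) `^ (q / 2 - 1)],
    and [q / 2 - 1] is nonnegative. *)
Lemma truncation_deriv_le1 (t : R) : 1 < t -> psi' t <= 1.
Proof.
move=> t1; have t0 : 0 < t by exact: lt_trans t1.
have -> : 1 = (t `^ al) `^ (p - 1) * t `^ (al - 1).
  rewrite -powRrM -powRD; last by rewrite (gt_eqF t0) implybT.
  by rewrite mulrBr alp mulr1 addrC subrKA subrr powRr0.
rewrite ler_wpM2r ?powR_ge0// ge0_ler_powR ?nnegrE ?powR_ge0 ?subr_ge0//.
  by rewrite ltW ?root_gt1.
by rewrite lerBlDr lerDl.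
Qed.

(** The increments from the corner at 1, which the mean value theorem on the
    right of 1 does not reach.  With [s = t `^ (2 / q)] one has
    [s - 1 <= t - 1 <= 1], and raising a number of the unit interval to the
    power [q / 2], which is at least 1, decreases it. *)
Lemma truncation_le_sub (t : R) : 1 < t -> t <= 2 -> psi t <= t - 1.
Proof.
move=> t1 t2; rewrite /psi t1.
have w0 : 0 < t `^ al - 1 by rewrite subr_gt0 root_gt1.
have wt : t `^ al - 1 <= t - 1 by rewrite lerB// ler1_powR// ltW.
apply: le_trans wt; apply: ge1r_powR => //; rewrite w0/=.
by rewrite lerBlDr (le_trans (ler1_powR _ _))// ltW.
Qed.

(** The mean value theorem applies on the right of 1, where the derivative lies
    between 0 and 1; the increments from 1 itself are bounded by going through
    the point 2. *)
Lemma truncation_incr (s t : R) : s <= t -> 0 <= psi t - psi s <= t - s.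
Proof.
have H u v : 1 < u -> u <= v -> 0 <= psi v - psi u <= v - u.
  move=> u1 uv.
  have [||c] := @MVT_segment R psi psi' u v uv.
  - by move=> x; rewrite in_itv/= => /andP[ux _]; apply: is_derive_truncation;
      exact: lt_trans ux.
  - apply: derivable_within_continuous => x; rewrite in_itv/= => /andP[ux _].
    by have [] := is_derive_truncation (lt_le_trans u1 ux).
  rewrite in_itv/= => /andP[uc _] ->.
  have c1 := lt_le_trans u1 uc.
  rewrite mulr_ge0 ?subr_ge0// ?(ltW (truncation_deriv_gt0 c1))//=.
  by rewrite ler_piMl ?subr_ge0// truncation_deriv_le1.
move=> st; have [t1|t1] := leP t 1.
  by rewrite !truncation_le1 ?subrr ?subr_ge0 ?lexx ?st// (le_trans st).
have [s1|s1] := leP s 1; last exact: H.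
rewrite (truncation_le1 s1) subr0 truncation_ge0/=.
apply: (@le_trans _ _ (t - 1)); last by rewrite lerB.
(* For [t] beyond 2, add the increments from 1 to 2 and from 2 to [t]. *)
have [t2|t2] := leP t 2; first exact: truncation_le_sub.
have h12 : (1 : R) < 2 by rewrite ltr1n.
have /andP[_] := H _ _ h12 (ltW t2).
have := truncation_le_sub h12 (lexx _).
lra.
Qed.

Lemma truncation_lipschitz (s t : R) : `|psi s - psi t| <= 1 * `|s - t|.
Proof.
wlog st : s t / s <= t.
  move=> H; case: (leP s t) => [|/ltW] st; first exact: H.
  by rewrite distrC (distrC s); exact: H.
have /andP[h0 h1] := truncation_incr st.
by rewrite mul1r distrC (distrC s) !ger0_norm// subr_ge0.
Qed.

Definition truncation_inv (y : R) : R := (y `^ al + 1) `^ p.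

Lemma truncationK (t : R) : 1 < t -> truncation_inv (psi t) = t.
Proof.
move=> t1; have t0 : 0 < t by exact: lt_trans t1.
rewrite /truncation_inv /psi t1 -powRrM (mulrC p) alp powRr1; last first.
  by rewrite subr_ge0 ltW// root_gt1.
by rewrite subrK rootK// ltW.
Qed.

Lemma derivable_truncation_inv (y : R) : 0 < y -> derivable truncation_inv y 1.
Proof.
move=> y0.
have d1 : is_derive y 1 (fun s : R => s `^ al + 1) (al * y `^ (al - 1)).
  have dp := is_derive1_powR al y0.
  have : is_derive y 1 ((@powR R ^~ al : R -> R) + cst 1) (al * y `^ (al - 1) + 0).
    exact: is_deriveD.
  by rewrite addr0.
have d2 : is_derive (y `^ al + 1) 1 (@powR R ^~ p) (p * (y `^ al + 1) `^ (p - 1)).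
  by apply: is_derive1_powR; rewrite addr_gt0// powR_gt0.
by have [] := @is_derive1_comp R (@powR R ^~ p) (fun s => s `^ al + 1) y _ _ d2 d1.
Qed.

Lemma truncation_log_derivE (t : R) : 1 < t ->
  t * psi' t / psi t = t `^ al / (t `^ al - 1).
Proof.
move=> t1; have t0 : 0 < t by exact: lt_trans t1.
have w0 : 0 < t `^ al - 1 by rewrite subr_gt0 root_gt1.
rewrite /psi t1 /psi' -(mulr_powRB1 (ltW t0) al0) in w0 *.
rewrite -(mulr_powRB1 (ltW w0) p0).
set w := _ - 1 in w0 *; set y := w `^ _.
have y0 : 0 < y by exact: powR_gt0.
by field; rewrite !gt_eqF.
Qed.

Lemma truncation_log_deriv_ge1 (t : R) : 1 < t -> 1 <= t * psi' t / psi t.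
Proof.
move=> t1; have w0 : 0 < t `^ al - 1 by rewrite subr_gt0 root_gt1.
by rewrite truncation_log_derivE// ler_pdivlMr// mul1r lerBlDr lerDl.
Qed.

(** The exponent [q / 2] of the truncation is chosen for this equality: the
    power [q] of the logarithmic derivative, which [H] produces, is compensated
    exactly by the decay of the truncation at 1. *)
Lemma truncation_log_deriv (t : R) : 1 < t ->
  psi t ^+ 2 * (t * psi' t / psi t) `^ q = t ^+ 2.
Proof.
move=> t1; have t0 : 0 < t by exact: lt_trans t1.
have w0 : 0 < t `^ al - 1 by rewrite subr_gt0 root_gt1.
rewrite truncation_log_derivE//.
have qE : q = p * 2 by rewrite divfK.
rewrite [in X in _ `^ X]qE powRrM powR_mulrn ?powR_ge0// -exprMn; congr (_ ^+ 2).
rewrite /psi t1 -powRM ?divr_ge0 ?powR_ge0 ?ltW//.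
by rewrite mulrC divfK ?gt_eqF// rootK// ltW.
Qed.

(** [truncation t / t] is the [q / 2]-th power of [1 - t `^ (- (2 / q))], which
    increases. *)
Lemma truncation_ratio (s t : R) : 1 < s -> s <= t -> psi s * t <= psi t * s.
Proof.
move=> s1 st; have t1 := lt_le_trans s1 st.
have s0 : 0 < s by exact: lt_trans s1.
have t0 : 0 < t by exact: lt_trans t1.
rewrite /psi s1 t1 -[X in _ * X <= _](rootK (ltW t0))
  -[X in _ <= _ * X](rootK (ltW s0)).
have ws : 0 < s `^ al - 1 by rewrite subr_gt0 root_gt1.
have wt : 0 < t `^ al - 1 by rewrite subr_gt0 root_gt1.
rewrite -!powRM ?powR_ge0 ?(ltW ws) ?(ltW wt)//.
have : s `^ al <= t `^ al.
  by apply: ge0_ler_powR; rewrite ?nnegrE ?(ltW al0) ?(ltW s0) ?(ltW t0).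
set x := s `^ al in ws *; set y := t `^ al in wt *; move=> xy.
apply: ge0_ler_powR; first exact: ltW.
- by rewrite nnegrE; nra.
- by rewrite nnegrE; nra.
- by lra.
Qed.

(** The monotonicity of [H x / x `^ q] as a growth condition; this is how a
    change of logarithmic derivative is paid for. *)
Lemma dilation_bound (H : R -> R) (lam y : R) :
  H 0 = 0 ->
  (forall x y, 0 < x -> x <= y -> H y / y `^ q <= H x / x `^ q) ->
  1 <= lam -> 0 <= y -> H (lam * y) <= lam `^ q * H y.
Proof.
move=> H0 Hq lam1; have lam0 : 0 < lam by exact: lt_le_trans lam1.
rewrite le_eqVlt => /predU1P[<-|y0]; first by rewrite mulr0 H0 mulr0.
have := Hq y (lam * y) y0; rewrite ler_peMl// ?(ltW y0)// => /(_ isT).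
rewrite ler_pdivrMr ?powR_gt0 ?mulr_gt0// powRM ?(ltW lam0) ?(ltW y0)//.
have yq0 : y `^ q != 0 by rewrite gt_eqF// powR_gt0.
by rewrite mulrCA divfK.
Qed.

End Truncation.

(** * A parabola above [x F(x)] *)

Lemma has_deriv_within_quotient (R : realType) (D : set R) (f : R -> R) (x l e : R) :
  nbhs x D -> has_deriv_within D f x l -> 0 < e ->
  \forall y \near x, y != x -> `|(f y - f x) / (y - x) - l| < e.
Proof.
move=> nD fl e0.
have : within D x^' [set y | `|l - (f y - f x) / (y - x)| < e].
  exact: (@cvgr_dist_lt _ _ _ _ _ _ _ fl e e0).
rewrite /within /dnbhs /= => H.
near=> y => yx; rewrite distrC; have Dy : D y by near: y.
move: yx Dy; near: y; exact: H.
Unshelve. all: by end_near. Qed.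

Lemma has_deriv_within_is_derive (R : realType) (D : set R) (f : R -> R) (x l : R) :
  nbhs x D -> has_deriv_within D f x l -> is_derive x 1 f l.
Proof.
move=> nD fl.
have H : (fun h => h^-1 *: ((f \o shift x) (h *: (1 : R)) - f x)) @ 0^' --> l.
  apply/cvgrPdist_lt => e e0.
  have := has_deriv_within_quotient nD fl e0.
  rewrite (near_shift 0) subr0 => Hn.
  have {}Hn : \forall h \near (0 : R)^', (h + x != x) ->
      `|(f (h + x) - f x) / (h + x - x) - l| < e by apply: cvg_within; exact: Hn.
  near=> h; have h0 : h != 0 by near: h; exact: nbhs_dnbhs_neq.
  have hx : h + x != x by rewrite -subr_eq0 addrK.
  rewrite distrC [h *: _]mulr1 /= [_ *: _]mulrC.
  have -> : h^-1 = (h + x - x)^-1 by rewrite addrK.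
  by move: hx; near: h.
split; first by apply/cvg_ex; exists l.
exact: cvg_lim.
Unshelve. all: by end_near. Qed.

(** The Taylor bound at 1.  By the mean value theorem
    [Phi x = f1 y * (x - 1)] with [y] between 1 and [x], and [f1 y - f1 1] is at
    most a constant times [y - 1] near 1, since [f1] is differentiable there.
    The slope is nonnegative if [Phi] is nonnegative on the right of 1. *)
Lemma C2_quadratic_majorant (R : realType) (b : R) (Phi : R -> R) :
  1 < b -> C2_on `[0, b] Phi -> Phi 1 = 0 ->
  exists a K d : R, [/\ 0 <= K, 0 < d,
    (forall x : R, `|x - 1| < d -> 0 <= x <= b),
    (forall x : R, `|x - 1| < d -> Phi x <= a * (x - 1) + K * (x - 1) ^+ 2) &
    (forall x : R, 1 < x -> x <= b -> 0 <= Phi x) -> 0 <= a].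
Proof.
move=> b1 [f1 [f2 [D1 D2 _]]] Phi1.
have nb (x : R) : 0 < x -> x < b -> nbhs x `[0, b]%classic.
  move=> x0 xb; apply: (@filterS _ _ _ `]0, b[%classic).
    by move=> y /=; rewrite !in_itv/= => /andP[? ?]; rewrite !ltW.
  by apply: near_in_itvoo; rewrite in_itv/= x0.
have d1 (x : R) : 0 < x -> x < b -> is_derive x 1 Phi (f1 x).
  move=> x0 xb; apply: (@has_deriv_within_is_derive _ `[0, b]%classic); first exact: nb.
  by apply: D1; rewrite /= in_itv/= !ltW.
have n1 := nb 1 ltr01 b1.
have in1 : `[0, b]%classic (1 : R) by exact: nbhs_singleton.
(* [d] also keeps the interval around 1 inside the domain of [Phi]. *)
have [d d0 Hd] : exists2 d : R, 0 < d & forall c : R, `|c - 1| < d ->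
    (0 < c < b) /\ `|f1 c - f1 1| <= (`|f2 1| + 1) * `|c - 1|.
  have q1 := has_deriv_within_quotient n1 (D2 _ in1) ltr01.
  have q2 : \forall y \near (1 : R), 0 < y < b.
    near=> y; apply/andP; split; near: y;
      [exact: lt_nbhsr|exact: lt_nbhsl].
  have [d /= d0 Hd] := filterI q1 q2.
  exists d => // c cd; have [|h1 h2] := Hd c.
    by rewrite /ball/= distrC.
  split => //; have [->|c1] := eqVneq c 1; first by rewrite !subrr !normr0 mulr0.
  have c10 : 0 < `|c - 1| by rewrite normr_gt0 subr_eq0.
  rewrite -ler_pdivrMr// -normf_div.
  rewrite -[X in `|X|](subrK (f2 1)) (le_trans (ler_normD _ _))// addrC lerD2l.
  exact/ltW/h1.
exists (f1 1), (`|f2 1| + 1), d; split => //.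
- by move=> x /Hd[/andP[? ?] _]; rewrite !ltW.
- move=> x xd.
  have mvt (u v : R) : u <= v -> (forall c : R, u <= c <= v -> `|c - 1| <= `|x - 1|) ->
      exists2 c : R, `|c - 1| <= `|x - 1| & Phi v - Phi u = f1 c * (v - u).
    move=> uv seg.
    have dseg (c : R) : c \in `[u, v] -> is_derive c 1 Phi (f1 c).
      rewrite in_itv/= => /seg h; have [/andP[? ?] _] := Hd _ (le_lt_trans h xd).
      exact: d1.
    have cPhi : {within `[u, v], continuous Phi}.
      by apply: derivable_within_continuous => c hc; have [] := dseg _ hc.
    have [c cx PhiE] := @MVT_segment R Phi f1 u v uv
      (fun c hc => dseg c (subset_itv_oo_cc hc)) cPhi.
    by exists c => //; apply: seg; move: cx; rewrite in_itv.
  have [c cx PhiE] : exists2 c : R, `|c - 1| <= `|x - 1| & Phi x = f1 c * (x - 1).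
    have [x1|x1] := leP x 1.
      have [|c cx e] := mvt _ _ x1; last by exists c => //; move: e; rewrite Phi1; lra.
      move=> c /andP[h1 h2]; rewrite (@ler0_norm _ (x - 1)); last by lra.
      by rewrite ler_norml; apply/andP; split; lra.
    have [|c cx e] := mvt _ _ (ltW x1); last by exists c => //; move: e; rewrite Phi1; lra.
    move=> c /andP[h1 h2]; rewrite (@ger0_norm _ (x - 1)); last by lra.
    by rewrite ler_norml; apply/andP; split; lra.
  have [_ fc] := Hd c (le_lt_trans cx xd).
  rewrite PhiE -lerBlDl -mulrBl (le_trans (ler_norm _))// normrM.
  rewrite -(@ger0_norm _ ((x - 1) ^+ 2)) ?sqr_ge0// normrX expr2 mulrA.
  apply: ler_wpM2r => //; apply: (le_trans fc).
  by apply: ler_wpM2l => //; rewrite addr_ge0.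
- move=> Phi0; rewrite leNgt; apply/negP => a0.
  have na0 : 0 < - f1 1 by rewrite oppr_gt0.
  have [r /= r0 Hr] := has_deriv_within_quotient n1 (D1 _ in1) na0.
  (* A point [1 + s] close enough to 1 for the quotient to have the sign of
     [f1 1], and small enough to stay in the domain. *)
  pose s := Num.min r (b - 1) / 2.
  have s0 : 0 < s by rewrite divr_gt0// lt_min r0 subr_gt0.
  have [sr sb] : s < r /\ s < b - 1.
    have m0 : 0 < Num.min r (b - 1) by rewrite lt_min r0 subr_gt0.
    have sm : s < Num.min r (b - 1) by rewrite /s; lra.
    by split; apply: (lt_le_trans sm); rewrite ge_min lexx ?orbT.
  have := Hr (1 + s); rewrite /ball/= opprD addNKr normrN gtr0_norm//.
  have ss : 1 + s - 1 = s by rewrite addrC addKr.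
  rewrite -subr_eq0 ss gt_eqF// Phi1 subr0 => /(_ sr isT).
  have : 0 <= Phi (1 + s) / s.
    by rewrite divr_ge0 ?(ltW s0)// Phi0; lra.
  rewrite ltr_norml => h /andP[_]; lra.
Unshelve. all: by end_near. Qed.

(** Near 1 the parabola comes from [C2_quadratic_majorant]; away from 1 the
    function is bounded above, by [L], while [(x - 1) ^+ 2] is bounded below, so
    increasing [K] suffices.  The slope is nonnegative because [x * F x] is, on
    the right of 1.  In the second case [x * d * (x - 1)] is itself
    [d * (x - 1) + d * (x - 1) ^+ 2].  The value [Phi0] at 0 is included, as it
    is the one that the integrand takes where [f] vanishes. *)
Lemma quadratic_majorant (R : realType) (F : R -> R) (A Phi0 : R) :
  (forall x y, 0 < x -> x <= y -> F x <= F y) -> F 1 = 0 -> 1 < A ->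
  (exists Phi : R -> R,
      [/\ forall x, 0 < x -> x <= A ^+ 2 -> Phi x = x * F x,
          C2_on `[0, A ^+ 2] Phi & Phi 0 = Phi0])
    \/
    ((exists2 d : R, 0 <= d &
       forall x, 0 < x -> x <= A ^+ 2 -> F x <= d * (x - 1)) /\ Phi0 = 0) ->
  exists a K : R, [/\ 0 <= a, 0 <= K & forall x, 0 <= x -> x <= A ^+ 2 ->
    (if x == 0 then Phi0 else x * F x) <= a * (x - 1) + K * (x - 1) ^+ 2].
Proof.
move=> Fmono F1 A1; set b := A ^+ 2.
have b1 : 1 < b by rewrite expr_gt1// ltW// (lt_trans _ A1).
have F0 x : 1 <= x -> 0 <= F x by move=> x1; rewrite -F1 Fmono.
case=> [[Phi [PhiE C2 Phi00]]|[[d d0 Fd] ->]]; last first.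
  exists d, d; split => // x; rewrite le_eqVlt => /predU1P[<- _|x0 xb].
    by rewrite eqxx sub0r sqrrN expr1n; lra.
  rewrite gt_eqF//; have := Fd x x0 xb; nra.
have Phi1 : Phi 1 = 0 by rewrite PhiE ?F1 ?mulr0// ltW.
have [a [K [d [K0 d0 dom near a0]]]] := C2_quadratic_majorant b1 C2 Phi1.
have {}a0 : 0 <= a.
  apply: a0 => x x1 xb; have x0 : 0 < x by exact: lt_trans x1.
  by rewrite PhiE// mulr_ge0 ?F0// ltW.
have valE x : 0 <= x -> x <= b -> (if x == 0 then Phi0 else x * F x) = Phi x.
  rewrite le_eqVlt => /predU1P[<-|x0] xb; first by rewrite eqxx.
  by rewrite gt_eqF// PhiE.
pose L := `|Phi0| + b * F b.
have bF0 : 0 <= b * F b by rewrite mulr_ge0 ?F0 ?ltW// (lt_trans _ b1).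
have PhiL x : 0 <= x -> x <= b -> Phi x <= L.
  rewrite le_eqVlt => /predU1P[<- _|x0 xb].
    by rewrite Phi00 /L (le_trans (ler_norm _))// lerDl.
  rewrite PhiE//; apply: (@le_trans _ _ (b * F b)); last by rewrite /L lerDr.
  have [x1|x1] := leP x 1.
    by apply: le_trans bF0; rewrite pmulr_rle0// -F1 Fmono.
  by apply: ler_pM => //; [exact: ltW|exact/F0/ltW|exact: Fmono].
have L0 : 0 <= L by rewrite /L addr_ge0.
exists a, (K + (L + a) / d ^+ 2); split => //.
  by rewrite addr_ge0// divr_ge0 ?addr_ge0 ?sqr_ge0.
move=> x x0 xb; rewrite valE//.
have e0 : 0 <= (L + a) / d ^+ 2 by rewrite divr_ge0 ?addr_ge0 ?sqr_ge0.
have [xd|xd] := ltP `|x - 1| d.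
  by apply: (le_trans (near _ xd)); rewrite lerD2l ler_wpM2r ?sqr_ge0// lerDl.
have : d ^+ 2 <= (x - 1) ^+ 2.
  by rewrite -(real_normK (num_real (x - 1))) lerXn2r ?nnegrE// ltW.
have d20 : 0 < d ^+ 2 by rewrite exprn_gt0.
move=> h; apply: (le_trans (PhiL _ x0 xb)).
have : L + a <= (L + a) / d ^+ 2 * (x - 1) ^+ 2.
  by rewrite mulrAC ler_pdivlMr// ler_wpM2l// addr_ge0.
have : 0 <= K * (x - 1) ^+ 2 by rewrite mulr_ge0// sqr_ge0.
rewrite mulrDl; nra.
Qed.

(** * Quadratic expressions in a function of unit mass *)

Section UnitMass.
Context d (T : measurableType d) (R : realType) (mu : probability T R).
Variable f : T -> R.
Hypothesis mf : measurable_fun setT f.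
Hypothesis f2 : (\int[mu]_x (f x ^+ 2)%:E = 1)%E.

Lemma unit_mass_integrable_sqr : mu.-integrable setT (EFin \o (fun x => f x ^+ 2)).
Proof.
apply/integrableP; split; first by apply/measurable_EFinP; exact: measurable_funX.
under eq_integral do rewrite /= ger0_norm ?sqr_ge0//.
by rewrite f2 ltry.
Qed.

Lemma unit_mass_integrable : mu.-integrable setT (EFin \o f).
Proof.
apply: (@le_integrable _ _ _ _ _ _ _ (EFin \o (fun x => 1 + f x ^+ 2))) => //.
- exact/measurable_EFinP.
- move=> x _; rewrite /= lee_fin (ger0_norm (addr_ge0 _ (sqr_ge0 _)))//.
  rewrite -(real_normK (num_real (f x))).
  set y := `|f x|; have := sqr_ge0 (y - 1); have : 0 <= y by exact: normr_ge0.
  nra.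
- have -> : EFin \o (fun x => 1 + f x ^+ 2) =
    (EFin \o cst 1) \+ (EFin \o (fun x => f x ^+ 2)) by [].
  apply: integrableD => //; last exact: unit_mass_integrable_sqr.
  exact: finite_measure_integrable_cst.
Qed.

Lemma unit_mass_integrable_quadratic (c0 c1 c2 : R) :
  mu.-integrable setT (EFin \o (fun x => c0 + c1 * f x + c2 * f x ^+ 2)).
Proof.
have -> : EFin \o (fun x => c0 + c1 * f x + c2 * f x ^+ 2) =
  ((EFin \o cst c0 : T -> \bar R) \+ (fun x => (c1%:E * (EFin \o f) x)%E)) \+
  (fun x => (c2%:E * (EFin \o (fun x => (f x ^+ 2)%R)) x)%E) by [].
apply: integrableD => //; last exact/integrableZl/unit_mass_integrable_sqr.
apply: integrableD => //; last exact/integrableZl/unit_mass_integrable.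
exact: finite_measure_integrable_cst.
Qed.

Lemma unit_mass_integral_quadratic (c0 c1 c2 : R) :
  (\int[mu]_x (c0 + c1 * f x + c2 * f x ^+ 2)%:E =
   (c0 + c1 * (\int[mu]_x f x)%R + c2)%:E)%E.
Proof.
have i0 : mu.-integrable setT (EFin \o cst c0) by exact: finite_measure_integrable_cst.
have i1 := integrableZl measurableT c1 unit_mass_integrable.
have i2 := integrableZl measurableT c2 unit_mass_integrable_sqr.
rewrite (_ : (fun x => _) =
  ((EFin \o cst c0 : T -> \bar R) \+ (fun x => (c1%:E * (EFin \o f) x)%E)) \+
  (fun x => (c2%:E * (EFin \o (fun x => (f x ^+ 2)%R)) x)%E))//.
have i01 := integrableD measurableT i0 i1.
rewrite (integralD measurableT i01 i2) (integralD measurableT i0 i1).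
rewrite (integralZl measurableT unit_mass_integrable).
rewrite (integralZl measurableT unit_mass_integrable_sqr).
rewrite f2 mule1 !EFinD EFinM /Rintegral fineK; last first.
  exact/integrable_fin_num/unit_mass_integrable.
suff -> : (\int[mu]_x (EFin \o cst c0) x = c0%:E)%E by [].
have := integral_cst mu measurableT c0%:E.
by rewrite -[X in (_ * X)%E]/(mu setT) probability_setT mule1.
Qed.

(** With [e] the mean of [f], this reads [2 - 2 e <= 2 (1 - e ^+ 2)], that is
    [e ^+ 2 <= e]; and [e <= 1] because the variance is nonnegative. *)
Lemma unit_mass_variance : (forall x, 0 <= f x) ->
  (\int[mu]_x ((f x - 1) ^+ 2)%:E <=
   2%:E * \int[mu]_x (`|f x - (\int[mu]_y f y)%R| ^+ 2)%:E)%E.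
Proof.
move=> f0; set e := (\int[mu]_y f y)%R.
have e0 : 0 <= e by apply: Rintegral_ge0.
have sqrE (c : R) : (\int[mu]_x ((f x - c) ^+ 2)%:E = (c ^+ 2 - 2 * c * e + 1)%:E)%E.
  rewrite -mulNr -unit_mass_integral_quadratic; apply: eq_integral => x _.
  by congr EFin; ring.
under [X in (_ <= _ * X)%E]eq_integral do rewrite real_normK ?num_real//.
have : (0 <= \int[mu]_x ((f x - e) ^+ 2)%:E)%E.
  by apply: integral_ge0 => x _; rewrite lee_fin sqr_ge0.
rewrite !sqrE -EFinM !lee_fin; nra.
Qed.

End UnitMass.

(** * The energy density *)

Section Energy.
Variables (R : realType) (n : nat) (M : ptopologicalType) (G : riemannian R n M).
Variable H : R -> R.

Lemma H_integrand_ge0 (f : M -> R) x :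
  (forall y, 0 <= H y) -> 0 <= H_integrand G H f x.
Proof. by move=> H0; rewrite /H_integrand; case: ifP => // _; rewrite mulr_ge0 ?sqr_ge0. Qed.

(** Where [f] vanishes the energy density is 0, and so is the gradient, since
    a nonnegative [f] has a minimum there. *)
Lemma grad_norm_sqr_le (f : M -> R) (c : R) x :
  0 < c -> (forall y, c * y ^+ 2 <= H y) -> (forall y, 0 <= f y) ->
  grad_norm G f x ^+ 2 <= c^-1 * H_integrand G H f x.
Proof.
move=> c0 Hc f0; rewrite ler_pdivlMl// /H_integrand; case: eqP => [fx|/eqP fx].
  by rewrite grad_norm_at_zero// expr0n/= mulr0.
have f2 : 0 < f x ^+ 2 by rewrite exprn_even_gt0.
have := Hc (grad_norm G f x / f x).
rewrite -(ler_pM2l f2); apply: le_trans.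
by rewrite le_eqVlt; apply/orP; left; apply/eqP; field.
Qed.

(** The truncation does not increase the energy density, at any point: it
    multiplies the logarithmic gradient of [f] by [t * psi' t / psi t] at
    [t = f x], which costs at most the [q]-th power of that number
    ([dilation_bound]), exactly what [truncation_log_deriv] compensates. *)
Lemma H_integrand_truncation (q : R) (f : M -> R) x :
  2 <= q -> H 0 = 0 -> (forall y, 0 <= H y) ->
  (forall x y, 0 < x -> x <= y -> H y / y `^ q <= H x / x `^ q) ->
  locally_lipschitz G f ->
  H_integrand G H (truncation q \o f) x <= H_integrand G H f x.
Proof.
move=> q2 H0 Hge0 Hq lf; have [f1|f1] := leP (f x) 1.
  by rewrite {1}/H_integrand /= truncation_le1// eqxx; exact: H_integrand_ge0.
have fx0 : 0 < f x by exact: lt_trans f1.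
have g0 := truncation_gt0 q2 f1.
rewrite /H_integrand (gt_eqF fx0) /= (gt_eqF g0).
have dpsi := is_derive_truncation q2 f1.
have nK : \forall t \near f x, truncation_inv q (truncation q t) = t.
  by near=> t; apply: truncationK => //; near: t; exact: lt_nbhsr.
rewrite (grad_norm_comp _ (locally_lipschitz_continuous lf) dpsi nK); last first.
  exact: derivable_truncation_inv.
rewrite gtr0_norm; last exact: truncation_deriv_gt0.
set y := grad_norm G f x.
have -> : truncation_deriv q (f x) * y / truncation q (f x) =
    f x * truncation_deriv q (f x) / truncation q (f x) * (y / f x).
  by field; rewrite !gt_eqF.
have y0 : 0 <= y / f x by rewrite divr_ge0 ?grad_norm_ge0// ltW.
have lam1 := truncation_log_deriv_ge1 q2 f1.
have := dilation_bound H0 Hq lam1 y0.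
rewrite -(ler_pM2l (exprn_gt0 2 g0)) [X in _ <= X]mulrA.
by rewrite (truncation_log_deriv q2 f1).
Unshelve. all: by end_near. Qed.

End Energy.

(** * Low and high values of a function of unit mass *)

Section Tightening.
Variables (R : realType) (n : nat) (M : ptopologicalType) (G : riemannian R n M).
Variables (mu : probability (borel M) R) (H F : R -> R) (A Phi0 : R).
Hypothesis H0 : H 0 = 0.
Hypothesis Fmono : forall x y, 0 < x -> x <= y -> F x <= F y.
Hypothesis F1 : F 1 = 0.
Hypothesis A1 : 1 < A.

Let A0 : 0 < A. Proof. exact: lt_trans A1. Qed.

Let F_ge0 x : 1 <= x -> 0 <= F x.
Proof. by move=> x1; rewrite -F1 Fmono. Qed.

Definition high_part (f : M -> R) (x : M) : R :=
  if f x < A then 0 else f x ^+ 2 * F (f x ^+ 2).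

Let sqr_ge1 (t : R) : A <= t -> 1 <= t ^+ 2.
Proof. by move=> At; rewrite exprn_ege1// (le_trans (ltW A1)). Qed.

Lemma high_part_ge0 f x : 0 <= high_part f x.
Proof.
rewrite /high_part; case: ltP => // /sqr_ge1 f1.
by rewrite mulr_ge0 ?sqr_ge0// F_ge0.
Qed.

(** As a function of the value of [f], the high part is nondecreasing: it is 0
    below [A], and a product of nonnegative nondecreasing factors above. *)
Lemma measurable_high_part (f : M -> R) :
  continuous f -> measurable_fun setT (high_part f : borel M -> R).
Proof.
move=> cf; pose theta (t : R) := if t < A then 0 else t ^+ 2 * F (t ^+ 2).
apply: (@measurableT_comp _ _ _ _ _ _ theta _ (f : borel M -> R)); last first.
  exact: continuous_borel_measurable.
apply: nondecreasing_measurable => // s t st; rewrite /theta.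
case: (ltP t A) => tA; first by rewrite (le_lt_trans st tA).
have t1 := sqr_ge1 tA; case: (ltP s A) => sA.
  by rewrite mulr_ge0 ?sqr_ge0// F_ge0.
have s1 := sqr_ge1 sA; have s0 : 0 <= s by exact: le_trans (ltW A0) sA.
have st2 : s ^+ 2 <= t ^+ 2 by rewrite lerXn2r// nnegrE// (le_trans s0).
by apply: ler_pM; rewrite ?sqr_ge0 ?F_ge0// Fmono// (lt_le_trans ltr01).
Qed.

Section UnitMassFunction.
Variable f : M -> R.
Hypothesis lf : locally_lipschitz G f.
Hypothesis f0 : forall x, 0 <= f x.
Hypothesis f2 : (\int[mu]_x (f x ^+ 2)%:E = 1)%E.

Let cf : continuous f. Proof. exact: locally_lipschitz_continuous lf. Qed.
Let mf : measurable_fun setT (f : borel M -> R).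
Proof. exact: continuous_borel_measurable. Qed.

(** The linear term of the parabola integrates to 0, and its slope makes the
    parabola nonnegative above [A], where it may thus be added to
    [high_part]. *)
Lemma F_integral_majorant (a K : R) : 0 <= a -> 0 <= K ->
  (forall x, 0 <= x -> x <= A ^+ 2 ->
    (if x == 0 then Phi0 else x * F x) <= a * (x - 1) + K * (x - 1) ^+ 2) ->
  (\int[mu]_x (F_integrand mu F Phi0 f x)%:E <=
   (K * (A + 1) ^+ 2)%:E * \int[mu]_x ((f x - 1) ^+ 2)%:E
   + \int[mu]_x (high_part f x)%:E)%E.
Proof.
move=> a0 K0 maj; set K' := K * (A + 1) ^+ 2.
have mass1 : mass mu f = 1 by rewrite /mass /Rintegral f2.
(* [a * (f ^+ 2 - 1) + K' * (f - 1) ^+ 2], expanded in powers of [f]. *)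
pose quad x := (K' - a) + (- (2 * K')) * f x + (a + K') * f x ^+ 2.
have ptw x : F_integrand mu F Phi0 f x <= quad x + high_part f x.
  have -> : quad x = a * (f x ^+ 2 - 1) + K' * (f x - 1) ^+ 2 by rewrite /quad; ring.
  have K'0 : 0 <= K' * (f x - 1) ^+ 2.
    by rewrite mulr_ge0 ?sqr_ge0// /K' mulr_ge0 ?sqr_ge0.
  rewrite /F_integrand mass1 divr1 mul1r /high_part; case: (ltP (f x) A) => fA.
    rewrite addr0.
    have fA2 : f x ^+ 2 <= A ^+ 2 by rewrite lerXn2r ?nnegrE// ltW.
    have := maj _ (sqr_ge0 (f x)) fA2; rewrite sqrf_eq0 => h; apply: (le_trans h).
    rewrite lerD2l /K' -mulrA ler_wpM2l// -exprMn.
    rewrite (_ : f x ^+ 2 - 1 = (f x + 1) * (f x - 1)); last by ring.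
    rewrite !exprMn ler_wpM2r ?sqr_ge0// lerXn2r ?nnegrE ?addr_ge0//.
      exact: ltW.
    by rewrite lerD2r ltW.
  rewrite gt_eqF ?(lt_le_trans A0)// lerDr addr_ge0// mulr_ge0// subr_ge0.
  exact: sqr_ge1.
have iq : mu.-integrable setT (EFin \o quad).
  exact: unit_mass_integrable_quadratic.
apply: (@le_trans _ _ (\int[mu]_x ((EFin \o quad) x + (high_part f x)%:E))%E).
  by apply: le_lower_integral => x; rewrite -EFinD lee_fin.
apply: le_trans (integralD_le iq _ _) _.
- by apply/measurable_EFinP; exact: measurable_high_part.
- by move=> x; rewrite lee_fin high_part_ge0.
rewrite leeD2r//.
have -> : (\int[mu]_x ((f x - 1) ^+ 2)%:E =
    \int[mu]_x (1 + (- 2) * f x + 1 * f x ^+ 2)%:E)%E.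
  by apply: eq_integral => x _; congr EFin; ring.
rewrite /comp !unit_mass_integral_quadratic// -EFinM lee_fin.
by rewrite le_eqVlt; apply/orP; left; apply/eqP; ring.
Qed.

Lemma truncation_sub_mass (q : R) : 2 <= q ->
  (\int[mu]_x (truncation q (f x) ^+ 2)%:E <= \int[mu]_x ((f x - 1) ^+ 2)%:E)%E.
Proof.
move=> q2; apply: le_lower_integral => x; rewrite lee_fin.
have := truncation_lipschitz q2 (f x) 1.
rewrite mul1r (truncation_le1 _ (lexx 1)) subr0 => h.
by rewrite -(real_normK (num_real (f x - 1))) -(real_normK (num_real (truncation q _)))
  lerXn2r ?nnegrE.
Qed.

(** The defective inequality for the truncation [g] of [f].  Where [A <= f] one
    has [th ^+ 2 * f ^+ 2 <= g ^+ 2], and the mass [m] of [g] is less than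
    [th ^+ 2], so [f ^+ 2 <= g ^+ 2 / m] and the monotonicity of [F] concludes;
    elsewhere the integrand of [g] is at least [m] times the lower bound of
    [x * F x] or [Phi0], whence the term with [`|b| + `|Phi0|]. *)
Lemma high_part_bound (q b D : R) : 2 <= q ->
  (forall y, 0 <= H y) ->
  (forall x y, 0 < x -> x <= y -> H y / y `^ q <= H x / x `^ q) ->
  (forall y, 0 < y -> b <= y * F y) -> 0 <= D ->
  (forall g : M -> R, admissible G mu g ->
    (\int[mu]_x (F_integrand mu F Phi0 g x)%:E <=
     \int[mu]_x (H_integrand G H g x)%:E + D%:E * \int[mu]_x (g x ^+ 2)%:E)%E) ->
  (\int[mu]_x ((f x - 1) ^+ 2)%:E < ((truncation q A / A) ^+ 2)%:E)%E ->
  (((truncation q A / A) ^+ 2)%:E * \int[mu]_x (high_part f x)%:E <=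
   \int[mu]_x (H_integrand G H f x)%:E
   + (D + (`|b| + `|Phi0|))%:E * \int[mu]_x ((f x - 1) ^+ 2)%:E)%E.
Proof.
move=> q2 Hge0 Hq Fb D0 hdef small; set th := truncation q A / A.
set V := (\int[mu]_x ((f x - 1) ^+ 2)%:E)%E.
pose g := truncation q \o f.
have th0 : 0 < th by rewrite divr_gt0// truncation_gt0.
have lg : locally_lipschitz G g.
  exact: locally_lipschitz_comp ltr01 (truncation_lipschitz q2) lf.
have mg : measurable_fun setT (g : borel M -> R).
  by apply: continuous_borel_measurable; exact: locally_lipschitz_continuous lg.
have gV : (\int[mu]_x (g x ^+ 2)%:E <= V)%E by exact: truncation_sub_mass.
have V0 : (0 <= V)%E by apply: integral_ge0 => x _; rewrite lee_fin sqr_ge0.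
have IH0 : (0 <= \int[mu]_x (H_integrand G H f x)%:E)%E.
  by apply: integral_ge0 => x _; rewrite lee_fin H_integrand_ge0.
have B0 : 0 <= `|b| + `|Phi0| by rewrite addr_ge0.
have g20 : (0 <= \int[mu]_x (g x ^+ 2)%:E)%E.
  by apply: integral_ge0 => x _; rewrite lee_fin sqr_ge0.
have mh : measurable_fun setT (high_part f : borel M -> R).
  exact: measurable_high_part.
have hg x : A <= f x -> th * f x <= g x.
  move=> Af; rewrite /th mulrAC ler_pdivrMr//; exact: truncation_ratio.
(* If [g] has mass 0 the defective inequality is not available for it, but then
   [f < A] almost everywhere. *)
have [gz|gnz] := eqVneq (\int[mu]_x (g x ^+ 2)%:E)%E 0%E.
  have -> : (\int[mu]_x (high_part f x)%:E = 0)%E.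
    pose sqg x : \bar R := (g x ^+ 2)%:E.
    have mg2 : measurable_fun setT (sqg : borel M -> \bar R).
      by apply/measurable_EFinP; exact: measurable_funX.
    have : (\int[mu]_x `|sqg x| = 0)%E.
      rewrite -[RHS]gz; apply: eq_integral => x _ /=.
      by rewrite ger0_norm ?sqr_ge0.
    move=> /(ae_eq_integral_abs mu measurableT mg2) ae.
    rewrite -(integral0 mu setT); apply: ae_eq_integral => //.
      exact/measurable_EFinP.
    apply: filterS ae => x /(_ I) /= [/eqP]; rewrite sqrf_eq0 => /eqP gx _.
    rewrite /high_part; case: ltP => // /[dup] Af /hg; rewrite gx.
    by rewrite pmulr_rle0// leNgt (lt_le_trans A0).
  rewrite mule0 adde_ge0// mule_ge0// lee_fin addr_ge0//.
have g2oo : (\int[mu]_x (g x ^+ 2)%:E < +oo)%E.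
  by apply: le_lt_trans gV _; apply: lt_trans small _; rewrite ltry.
have g2pos : (0 < \int[mu]_x (g x ^+ 2)%:E)%E by rewrite lt0e gnz.
pose m := mass mu g.
have mE : (\int[mu]_x (g x ^+ 2)%:E = m%:E)%E.
  by rewrite /m /mass /Rintegral fineK// ge0_fin_numE.
have m0 : 0 < m by rewrite -lte_fin -mE.
have mth : m < th ^+ 2 by rewrite -lte_fin -mE (le_lt_trans gV).
have ptw x : th ^+ 2 * high_part f x <=
    F_integrand mu F Phi0 g x + (`|b| + `|Phi0|) * m.
  rewrite /F_integrand -/m /high_part; case: ltP => fA.
    rewrite mulr0; case: eqP => [_|/eqP gx].
      rewrite [m * _]mulrC -mulrDl mulr_ge0//; last exact: ltW.
      by have := ler_norm (- Phi0); rewrite normrN; have := normr_ge0 b; lra.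
    have y0 : 0 < g x ^+ 2 / m by rewrite divr_gt0// exprn_even_gt0.
    have := Fb _ y0; rewrite -(ler_pM2r m0).
    rewrite (_ : g x ^+ 2 / m * F (g x ^+ 2 / m) * m = g x ^+ 2 * F (g x ^+ 2 / m)); last first.
      by field; rewrite gt_eqF.
    have := ler_norm (- b); rewrite normrN; have := normr_ge0 Phi0; nra.
  have f1 := sqr_ge1 fA; have fx0 : 0 < f x by exact: lt_le_trans fA.
  have gx := hg _ fA; have gx0 : 0 < g x by apply: lt_le_trans gx; rewrite mulr_gt0.
  rewrite gt_eqF//.
  have g2 : th ^+ 2 * f x ^+ 2 <= g x ^+ 2.
    rewrite -exprMn lerXn2r ?nnegrE//; last exact: ltW.
    by rewrite mulr_ge0// ltW.
  have fg : f x ^+ 2 <= g x ^+ 2 / m.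
    rewrite ler_pdivlMr//; apply: le_trans g2; rewrite mulrC ler_wpM2r ?sqr_ge0//.
    exact: ltW.
  apply: (@le_trans _ _ (g x ^+ 2 * F (g x ^+ 2 / m))); last first.
    by rewrite lerDl mulr_ge0// ltW.
  rewrite mulrA; apply: ler_pM => //.
  - by rewrite mulr_ge0// sqr_ge0.
  - exact: F_ge0.
  - by apply: Fmono => //; exact: lt_le_trans f1.
rewrite -lower_integralZl ?exprn_gt0//.
have -> : (\int[mu]_x ((th ^+ 2)%:E * (high_part f x)%:E) =
    \int[mu]_x (th ^+ 2 * high_part f x)%:E)%E by [].
apply: (le_trans (@integral_le_addr_cst _ _ _ mu _ (F_integrand mu F Phi0 g)
   ((`|b| + `|Phi0|) * m) _ _ _ ptw)).
- exact: measurable_funM.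
- by rewrite mulr_ge0// ltW.
- by move=> x; rewrite mulr_ge0 ?sqr_ge0// high_part_ge0.
have adm : admissible G mu g by split => //; rewrite g2pos.
apply: (le_trans (leeD2r _ (hdef _ adm))).
rewrite mE -addeA leeD//.
  by apply: le_lower_integral => x; rewrite lee_fin H_integrand_truncation.
rewrite -EFinM -EFinD -mulrDl EFinM; apply: lee_wpmul2l.
  by rewrite lee_fin addr_ge0.
by rewrite -mE.
Qed.

End UnitMassFunction.
End Tightening.

(** * Tightening *)

(** The Poincare inequality followed by the pointwise bound of the squared
    gradient by the energy density.  The maximum with 0 is there because only a
    nonnegative factor preserves the second comparison. *)
Lemma variance_energy (R : realType) (n : nat) (M : ptopologicalType)
    (G : riemannian R n M) (mu : probability (borel M) R) (H : R -> R) (c E : R)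
    (f : M -> R) :
  0 < c -> (forall y, c * y ^+ 2 <= H y) ->
  (forall f, locally_lipschitz G f -> mu.-integrable setT (EFin \o f) ->
    (\int[mu]_x (`|f x - \int[mu]_y f y| ^+ 2)%:E <=
     E%:E * \int[mu]_x (grad_norm G f x ^+ 2)%:E)%E) ->
  locally_lipschitz G f -> (forall x, 0 <= f x) ->
  (\int[mu]_x (f x ^+ 2)%:E = 1)%E ->
  (\int[mu]_x ((f x - 1) ^+ 2)%:E <=
   (2 * Num.max E 0 / c)%:E * \int[mu]_x (H_integrand G H f x)%:E)%E.
Proof.
move=> c0 Hc hE lf f0 f2.
have mf : measurable_fun setT (f : borel M -> R).
  by apply: continuous_borel_measurable; exact: locally_lipschitz_continuous lf.
have ci0 : 0 < c^-1 by rewrite invr_gt0.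
have H0 y : 0 <= H y by apply: le_trans (Hc y); rewrite mulr_ge0 ?sqr_ge0// ltW.
have M0 : 0 <= Num.max E 0 by rewrite le_max lexx orbT.
apply: (le_trans (unit_mass_variance mf f2 f0)).
rewrite -mulrA EFinM -muleA; apply: lee_wpmul2l; first by rewrite lee_fin.
apply: (le_trans (hE f lf (unit_mass_integrable mf f2))).
apply: (@le_trans _ _ ((Num.max E 0)%:E * \int[mu]_x (grad_norm G f x ^+ 2)%:E)%E).
  apply: lee_wpmul2r; last by rewrite lee_fin le_max lexx.
  by apply: integral_ge0 => x _; rewrite lee_fin sqr_ge0.
rewrite EFinM -muleA; apply: lee_wpmul2l; first by rewrite lee_fin.
rewrite -lower_integralZl//; apply: le_lower_integral => x.
by rewrite -EFinM lee_fin grad_norm_sqr_le.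
Qed.

(** The dichotomy on the size [v] of the integral of [(f - 1) ^+ 2]; the constant
    is the sum of those of the two cases, [C1] and [C2]. *)
Lemma tight_unit_mass (R : realType) (n : nat) (M : ptopologicalType)
    (G : riemannian R n M) (mu : probability (borel M) R) (H F : R -> R)
    (c q b A Phi0 a K D E : R) :
  H 0 = 0 -> 0 < c -> (forall x, c * x ^+ 2 <= H x) -> 2 <= q ->
  (forall x y, 0 < x -> x <= y -> H y / y `^ q <= H x / x `^ q) ->
  (forall x y, 0 < x -> x <= y -> F x <= F y) -> F 1 = 0 ->
  (forall x, 0 < x -> b <= x * F x) -> 1 < A ->
  0 <= a -> 0 <= K ->
  (forall x, 0 <= x -> x <= A ^+ 2 ->
    (if x == 0 then Phi0 else x * F x) <= a * (x - 1) + K * (x - 1) ^+ 2) ->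
  0 <= D ->
  (forall f : M -> R, admissible G mu f ->
    (\int[mu]_x (F_integrand mu F Phi0 f x)%:E <=
     \int[mu]_x (H_integrand G H f x)%:E + D%:E * \int[mu]_x (f x ^+ 2)%:E)%E) ->
  (forall f, locally_lipschitz G f -> mu.-integrable setT (EFin \o f) ->
    (\int[mu]_x (`|f x - \int[mu]_y f y| ^+ 2)%:E <=
     E%:E * \int[mu]_x (grad_norm G f x ^+ 2)%:E)%E) ->
  exists2 C : R, 0 < C & forall f : M -> R, locally_lipschitz G f ->
    (forall x, 0 <= f x) -> (\int[mu]_x (f x ^+ 2)%:E = 1)%E ->
    (\int[mu]_x (F_integrand mu F Phi0 f x)%:E <=
     C%:E * \int[mu]_x (H_integrand G H f x)%:E)%E.
Proof.
move=> H0 c0 Hc q2 Hq Fmono F1 Fb A1 a0 K0 maj D0 hdef hE.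
have Hge0 y : 0 <= H y by apply: le_trans (Hc y); rewrite mulr_ge0 ?sqr_ge0// ltW.
set th2 := (truncation q A / A) ^+ 2.
have th0 : 0 < th2.
  by rewrite exprn_gt0// divr_gt0 ?truncation_gt0// (lt_trans _ A1).
pose k := 2 * Num.max E 0 / c.
have k0 : 0 <= k.
  by rewrite divr_ge0 ?(ltW c0)// mulr_ge0// le_max lexx orbT.
pose B := `|b| + `|Phi0|; pose K' := K * (A + 1) ^+ 2.
have B0 : 0 <= B by rewrite addr_ge0.
have K'0 : 0 <= K' by rewrite mulr_ge0 ?sqr_ge0.
pose C1 := 1 + D * k / th2; pose C2 := K' * k + (1 + (D + B) * k) / th2.
have C10 : 0 < C1.
  by rewrite ltr_wpDr// divr_ge0 ?(ltW th0)// mulr_ge0.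
have C20 : 0 <= C2.
  apply: addr_ge0; first exact: mulr_ge0.
  apply: divr_ge0; last exact: ltW.
  by apply: addr_ge0 => //; apply: mulr_ge0 => //; exact: addr_ge0.
exists (C1 + C2); first by rewrite ltr_wpDr.
move=> f lf f0 f2; set IF := (\int[mu]_x (F_integrand _ _ _ _ x)%:E)%E.
set IH := (\int[mu]_x (H_integrand _ _ _ x)%:E)%E.
have IH0 : (0 <= IH)%E by apply: integral_ge0 => x _; rewrite lee_fin H_integrand_ge0.
have CC0 : 0 < C1 + C2 by rewrite ltr_wpDr.
have := variance_energy c0 Hc hE lf f0 f2; rewrite -/k -/IH.
have := high_part_bound H0 Fmono F1 A1 lf f0 q2 Hge0 Hq Fb D0 hdef; rewrite -/th2 -/IH -/B.
have := F_integral_majorant Fmono F1 A1 lf f0 f2 a0 K0 maj.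
rewrite -/IF -/K'.
have adm : admissible G mu f by split => //; rewrite f2 lte_fin ltr01 ltry.
have := hdef f adm; rewrite -/IF -/IH f2 mule1.
have h0 : (0 <= \int[mu]_x (high_part F A f x)%:E)%E.
  by apply: integral_ge0 => x _; rewrite lee_fin high_part_ge0.
set h := (\int[mu]_x (high_part F A f x)%:E)%E in h0 *.
have V0 : (0 <= \int[mu]_x ((f x - 1) ^+ 2)%:E)%E.
  by apply: integral_ge0 => x _; rewrite lee_fin sqr_ge0.
set V := (\int[mu]_x ((f x - 1) ^+ 2)%:E)%E in V0 *.
move: IH0; case: IH => [r||] //; last first.
  by move=> _ _ _ _ _; rewrite gt0_muley ?lte_fin// leey.
rewrite lee_fin => r0 hD hmaj hhigh hV.
have Voo : V \is a fin_num by rewrite ge0_fin_numE// (le_lt_trans hV)// -EFinM ltry.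
move: V0 hmaj hhigh hV; rewrite -(fineK Voo); set v := fine V.
rewrite -!EFinM -EFinD lee_fin => v0 hmaj hhigh; rewrite lee_fin => vk.
have [big|small] := leP th2 v.
  apply: (le_trans hD); rewrite -EFinD lee_fin.
  have : D <= D * k / th2 * r.
    have big1 : 1 <= k / th2 * r by rewrite mulrAC ler_pdivlMr// mul1r (le_trans big).
    by have := ler_wpM2l D0 big1; rewrite mulr1 !mulrA.
  have : 0 <= C2 * r by rewrite mulr_ge0.
  by rewrite /C1; lra.
move: small; rewrite -lte_fin => /hhigh hhs.
have hoo : h \is a fin_num.
  rewrite ge0_fin_numE//; move: h0 hhs; case: (h) => [? _ _|_|//]; first exact: ltry.
  by rewrite gt0_muley ?lte_fin.
move: hmaj hhs; rewrite -(fineK hoo); set w := fine h.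
rewrite -EFinD -EFinM lee_fin => hmajw hhw.
apply: (le_trans hmajw); rewrite lee_fin.
have : w <= (1 + (D + B) * k) / th2 * r.
  have hDB : (D + B) * v <= (D + B) * (k * r) by rewrite ler_wpM2l// addr_ge0.
  by rewrite mulrAC ler_pdivlMr//; lra.
have : K' * v <= K' * k * r by rewrite -mulrA ler_wpM2l.
have : 0 <= C1 * r by rewrite mulr_ge0// ltW.
by rewrite /C2; lra.
Qed.

(** * Normalization *)

Section Normalization.
Variables (R : realType) (n : nat) (M : ptopologicalType) (G : riemannian R n M).
Variables (mu : probability (borel M) R) (f : M -> R).
Hypothesis adm : admissible G mu f.

Let m := mass mu f.
Let s := Num.sqrt m.

Definition normalized (x : M) : R := `|f x| / s.

Lemma mass_integral : (\int[mu]_x (f x ^+ 2)%:E = (mass mu f)%:E)%E.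
Proof.
case: adm => _ /andP[f20 f2oo]; rewrite /mass /Rintegral fineK// ge0_fin_numE//.
exact: ltW.
Qed.

Lemma mass_gt0 : 0 < mass mu f.
Proof. by case: adm => _ /andP[f20 _]; rewrite -lte_fin -mass_integral. Qed.

Let s0 : 0 < s. Proof. by rewrite sqrtr_gt0 mass_gt0. Qed.
Let s2 : s ^+ 2 = m. Proof. by rewrite sqr_sqrtr// ltW// mass_gt0. Qed.

Lemma normalized_sqr x : normalized x ^+ 2 = f x ^+ 2 / m.
Proof. by rewrite /normalized expr_div_n s2 real_normK ?num_real. Qed.

Lemma normalized_ge0 x : 0 <= normalized x.
Proof. by rewrite /normalized divr_ge0// ltW. Qed.

Lemma normalized_lipschitz : locally_lipschitz G normalized.
Proof.
have si0 : 0 < s^-1 by rewrite invr_gt0.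
apply: (@locally_lipschitz_comp _ _ _ G f (fun t => `|t| / s) _ si0).
  move=> t u; rewrite -mulrBl normrM (gtr0_norm si0) mulrC.
  by rewrite ler_wpM2l ?(ltW si0)// ler_dist_dist.
by case: adm.
Qed.

Lemma normalized_mass : (\int[mu]_x (normalized x ^+ 2)%:E = 1)%E.
Proof.
under eq_integral do rewrite normalized_sqr mulrC EFinM.
rewrite lower_integralZl ?invr_gt0 ?mass_gt0// mass_integral -EFinM mulVf//.
by rewrite gt_eqF// mass_gt0.
Qed.

Lemma F_integrand_normalized F Phi0 x :
  F_integrand mu F Phi0 f x = m * F_integrand mu F Phi0 normalized x.
Proof.
have m1 : mass mu normalized = 1 by rewrite /mass /Rintegral normalized_mass.
rewrite /F_integrand m1 divr1 mul1r normalized_sqr -/m.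
rewrite {1}/normalized mulf_eq0 normr_eq0 invr_eq0 (gt_eqF s0) orbF.
case: eqP => // _; rewrite mulrA mulrCA divff ?mulr1//.
by rewrite gt_eqF// mass_gt0.
Qed.

(** Where [f] does not vanish it keeps a constant sign [e] in a neighbourhood,
    on which the absolute value is [e] times the identity; the evenness of [H]
    absorbs the sign. *)
Lemma H_integrand_normalized H x : (forall y, H (- y) = H y) ->
  H_integrand G H normalized x = m^-1 * H_integrand G H f x.
Proof.
move=> Heven; rewrite /H_integrand normalized_sqr.
rewrite {1}/normalized mulf_eq0 normr_eq0 invr_eq0 (gt_eqF s0) orbF.
case: eqP => [_|/eqP fx]; first by rewrite mulr0.
have cf : continuous f by case: adm => lf _; exact: locally_lipschitz_continuous lf.
pose e := Num.sg (f x).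
have e2 : e * e = 1 by rewrite -expr2 sqr_sg fx.
have near_sg : \forall t \near f x, `|t| = e * t.
  move: fx; rewrite neq_lt /e => /orP[fx|fx]; near=> t.
    rewrite ltr0_sg// mulN1r ltr0_norm//; near: t; exact: lt_nbhsl.
  rewrite gtr0_sg// mul1r gtr0_norm//; near: t; exact: lt_nbhsr.
have dth : is_derive (f x) 1 (fun t => `|t| / s) (e / s).
  have d1 : is_derive (f x) 1 ((e / s) *: (id : R -> R)) (e / s).
    by rewrite -[X in is_derive _ _ _ X]mulr1; exact: is_deriveZ.
  apply: near_eq_is_derive d1; near=> t.
  have tE : `|t| = e * t by near: t.
  by rewrite tE mulrAC.
have gE : grad_norm G normalized x = `|e / s| * grad_norm G f x.
  apply: (@grad_norm_comp _ _ _ G f (fun t => `|t| / s) ((e * s) *: (id : R -> R))) => //.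
  near=> t; have tE : `|t| = e * t by near: t.
  have -> : ((e * s) *: (id : R -> R)) (`|t| / s) = e * e * t.
    by rewrite -[LHS]/(e * s * (`|t| / s)) tE; field; rewrite gt_eqF.
  by rewrite e2 mul1r.
rewrite gE normrM normfV (gtr0_norm s0) /e normr_sg fx mul1r /normalized.
have -> : s^-1 * grad_norm G f x / (`|f x| / s) = grad_norm G f x / `|f x|.
  by field; rewrite normr_eq0 fx gt_eqF.
have -> : H (grad_norm G f x / `|f x|) = H (grad_norm G f x / f x).
  have [f0|f0] := ltP (f x) 0; last by rewrite ger0_norm.
  by rewrite ltr0_norm// invrN mulrN Heven.
by rewrite mulrA [m^-1 * _]mulrC.
Unshelve. all: by end_near. Qed.

End Normalization.

Theorem theorem2p4 (R : realType) (n : nat) (M : ptopologicalType)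
    (G : riemannian R n M)
    (vol : {measure set (borel M) -> \bar R}) (hvol : is_volume G vol)
    (mu : probability (borel M) R) (hmu : mu `<< vol)
    (H : R -> R)
    (Heven : forall x, H (- x) = H x)
    (Hincr : forall x y, 0 <= x -> x < y -> H x < H y)
    (H0 : H 0 = 0)
    (Hquad : exists2 c : R, 0 < c & forall x, c * x ^+ 2 <= H x)
    (Hq : exists2 q : R, 2 <= q &
      forall x y, 0 < x -> x <= y -> H y / y `^ q <= H x / x `^ q)
    (F : R -> R)
    (Fmono : forall x y, 0 < x -> x <= y -> F x <= F y)
    (F1 : F 1 = 0)
    (Fbnd : exists b : R, forall x, 0 < x -> b <= x * F x)
    (A : R) (A1 : 1 < A) (Phi0 : R)
    (Fcase :
      (exists Phi : R -> R,
        [/\ forall x, 0 < x -> x <= A ^+ 2 -> Phi x = x * F x,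
            C2_on `[0, A ^+ 2] Phi & Phi 0 = Phi0])
      \/
      ((exists2 d : R, 0 <= d &
         forall x, 0 < x -> x <= A ^+ 2 -> F x <= d * (x - 1)) /\
       Phi0 = 0))
    (D : R) (D0 : 0 <= D)
    (hdef : forall f : M -> R, admissible G mu f ->
      (\int[mu]_x (F_integrand mu F Phi0 f x)%:E <=
       \int[mu]_x (H_integrand G H f x)%:E
         + D%:E * \int[mu]_x (f x ^+ 2)%:E)%E)
    (hpoinc : poincare G mu) :
  exists C : R, forall f : M -> R, admissible G mu f ->
    (\int[mu]_x (F_integrand mu F Phi0 f x)%:E <=
     C%:E * \int[mu]_x (H_integrand G H f x)%:E)%E.
Proof.
have [c c0 Hc] := Hquad; have [q q2 Hqq] := Hq; have [b Fb] := Fbnd.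
have [E hE] := hpoinc.
have [a [K [a0 K0 maj]]] := quadratic_majorant Fmono F1 A1 Fcase.
have [C C0 tight] :=
  tight_unit_mass H0 c0 Hc q2 Hqq Fmono F1 Fb A1 a0 K0 maj D0 hdef hE.
exists C => f adm; have m0 := mass_gt0 adm.
have := tight _ (normalized_lipschitz adm) (normalized_ge0 adm) (normalized_mass adm).
rewrite -(@lee_pmul2l _ (mass mu f)%:E)// -lower_integralZl//.
under eq_integral do rewrite -EFinM -(F_integrand_normalized adm).
move=> /le_trans; apply.
under eq_integral do rewrite (H_integrand_normalized adm _ Heven) EFinM.
rewrite lower_integralZl ?invr_gt0// muleCA [X in (_ * X)%E]muleA -EFinM divff ?mul1e//.
by rewrite gt_eqF.
Qed.
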